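(* Let $p\ge 5$ be a prime and let $r$ be an integer with $1\le r\le p-1$ such that $12r+1$ is a quadratic non-residue modulo $p$. Then for all integers $n\ge 0$ and all integers $k\ge j\ge 0$, \[ a_{p(k-j)+(p-1),\;pk+p}(pn+r)\equiv 0 \pmod p. \]
   Context: For positive integers $r,s$, $a_{r,s}(n)$ denotes the number of multicolored partitions of $n$ in which each even part may appear in one of $r$ colors and each odd part may appear in one of $s$ colors (copies of the same part size in different colors are distinct), with $a_{r,s}(0)=1$. Equivalently, for $|q|<1$, $\sum_{n\ge0}a_{r,s}(n)q^n = f_2^{s-r}/f_1^{s}$, where $f_m=\prod_{i\ge1}(1-q^{mi})$. *)

(* Defs.v *)
From HB Require Import structures.
From mathcomp Require Import all_boot.

Set Implicit Arguments.
Unset Strict Implicit.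
Unset Printing Implicit Defensive.

Definition ncolors (r s i : nat) : nat := if odd i then s else r.

(* [Tagged _ c] with tag [i : 'I_n] stands for the part of size [i.+1] (hence
   between 1 and [n]) in color [c]. *)
Definition colored_part (r s n : nat) : finType :=
  {i : 'I_n & 'I_(ncolors r s i.+1)}.

Definition part_size (r s n : nat) (x : colored_part r s n) : nat :=
  (tag x).+1.

(* A multicolored partition of [n] is given by the multiplicity of each colored
   part. Parts larger than [n] and multiplicities larger than [n] cannot occur,
   so the finite bounds lose nothing. *)
Definition multicolored_partitions (r s n : nat) :
    {set {ffun colored_part r s n -> 'I_n.+1}} :=
  [set m : {ffun colored_part r s n -> 'I_n.+1} |
    \sum_(x : colored_part r s n) m x * part_size x == n].

Definition a (r s n : nat) : nat := #|multicolored_partitions r s n|.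

Lemma a0 (r s : nat) : a r s 0 = 1.
Proof.
rewrite /a /multicolored_partitions.
have no_part (x : colored_part r s 0) : False by case: x => -[].
rewrite (_ : finset _ = setT).
  rewrite cardsT card_ffun card_ord exp1n //.
by apply/setP => m; rewrite !inE big1 // => x; case: (no_part x).
Qed.

Definition quadratic_nonresidue (p m : nat) : Prop :=
  coprime m p /\ ~ (exists x : nat, x ^ 2 = m %[mod p]).

(* Main.v *)
Require Import Defs.
From HB Require Import structures.
From mathcomp Require Import all_boot.
From mathcomp Require Import all_algebra zify ring.

(** With [s - r = p j + 1] and [s = p (k + 1)], the generating function
    [f_2^(s-r) / f_1^s] is [f_2 * H^p] with [H = f_2^j / f_1^(k+1)].  Modulo [p],
    [H^p] is supported on multiples of [p], while by Euler's pentagonal number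
    theorem [f_2] is supported on the exponents [e = m (3 m - 1)], for which
    [12 e + 1 = (6 m - 1)^2].  So a nonzero coefficient at [p n + r] makes
    [12 r + 1] a square modulo [p].  Power series are handled as polynomials
    modulo ['X^n], and the pentagonal number theorem is obtained from Shanks'
    finite identity. *)

Set Implicit Arguments.
Unset Strict Implicit.
Unset Printing Implicit Defensive.

Import GRing.Theory.
Local Open Scope ring_scope.

Section Shanks.
Variable R : comNzRingType.
Implicit Types (y : R) (s n : nat).

(** The quotient [(y^2; y^2)_n / (y^2; y^2)_s] for [s <= n], written without division. Working in
    base [y^2] gives [f_2] directly and avoids halved exponents. *)
Definition qfact_ratio y s n : R := \prod_(s <= i < n) (1 - y ^+ (2 * i.+1)).

Definition shanks_term y n s : R :=
  (-1) ^+ s * qfact_ratio y s n * y ^+ (2 * s * n + s * s.+1).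

Definition shanks_sum y n : R := \sum_(s < n.+1) shanks_term y n s.

Lemma shanks_sum0 y : shanks_sum y 0 = 1.
Proof.
by rewrite /shanks_sum big_ord1 /shanks_term /qfact_ratio big_geq // !mul1r.
Qed.

(* The difference of the two sums telescopes: [shanks_term y n s] multiplied by
   [1 - y ^+ (2 * s)] is minus the [T] of index [s - 1]. *)
Lemma shanks_sumS y n :
  shanks_sum y n.+1 = shanks_sum y n +
    (-1) ^+ n.+1 * (y ^+ (n.+1 * (3 * n + 4)) + y ^+ (n.+1 * (3 * n + 2))).
Proof.
pose T s : R :=
  (-1) ^+ s * qfact_ratio y s n * y ^+ (2 * s.+1 * n.+1 + s * s.+1).
have stepE s : (s <= n)%N -> shanks_term y n.+1 s =
    shanks_term y n s - (shanks_term y n s * (1 - y ^+ (2 * s)) + T s).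
  move=> le_sn; rewrite /shanks_term /T {1}/qfact_ratio big_nat_recr //=.
  rewrite -/(qfact_ratio y s n).
  rewrite (_ : 2 * s * n.+1 + s * s.+1 = (2 * s * n + s * s.+1) + 2 * s)%N;
    last by lia.
  rewrite (_ : 2 * s.+1 * n.+1 + s * s.+1 =
    (2 * s * n + s * s.+1) + 2 * s + 2 * n.+1)%N; last by lia.
  by rewrite !exprD; ring.
have telE s : (s < n)%N ->
    shanks_term y n s.+1 * (1 - y ^+ (2 * s.+1)) = - T s.
  move=> lt_sn; rewrite /shanks_term /T /qfact_ratio (big_ltn lt_sn) exprS.
  rewrite (_ : 2 * s.+1 * n + s.+1 * s.+2 = 2 * s.+1 * n.+1 + s * s.+1)%N;
    last by lia.
  by ring.
rewrite /shanks_sum big_ord_recr /=.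
rewrite (eq_bigr _ (fun (s : 'I_n.+1) _ => stepE s (ltn_ord s))).
rewrite sumrB -addrA; congr (_ + _); rewrite big_split /= big_ord_recl /=.
rewrite (eq_bigr _ (fun (s : 'I_n) _ => telE s (ltn_ord s))).
rewrite sumrN [\sum_(i < n.+1) T i]big_ord_recr /= muln0 expr0 subrr mulr0 add0r.
(* Two boundary terms survive: [- T n] and the term of index [n.+1] of the new sum. *)
rewrite addrA addNr add0r /T /shanks_term /qfact_ratio !big_geq // !mulr1.
rewrite (_ : 2 * n.+1 * n.+1 + n.+1 * n.+2 = n.+1 * (3 * n + 4))%N; last by lia.
rewrite (_ : 2 * n.+1 * n.+1 + n * n.+1 = n.+1 * (3 * n + 2))%N; last by lia.
by rewrite exprS; ring.
Qed.

End Shanks.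

Section PowerSeriesModXn.
Variable R : comNzRingType.
Implicit Types (f g h : {poly R}) (n : nat).

Definition eqmodX n f g : Prop := exists h, f = g + h * 'X^n.

Lemma eqmodX_coef n f g i : eqmodX n f g -> (i < n)%N -> f`_i = g`_i.
Proof. by case=> h -> lt_in; rewrite coefD coefMXn lt_in addr0. Qed.

Lemma eqmodX_refl n f : eqmodX n f f.
Proof. by exists 0; rewrite mul0r addr0. Qed.

Lemma eqmodXM n f f' g g' :
  eqmodX n f f' -> eqmodX n g g' -> eqmodX n (f * g) (f' * g').
Proof.
move=> [h ->] [h' ->]; exists (f' * h' + h * g' + h * h' * 'X^n); ring.
Qed.

Lemma eqmodXX n f g k : eqmodX n f g -> eqmodX n (f ^+ k) (g ^+ k).
Proof.
move=> fg; elim: k => [|k IHk]; first exact: eqmodX_refl.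
by rewrite !exprS; apply: eqmodXM.
Qed.

Lemma eqmodX_prod n (I : finType) (F G : I -> {poly R}) :
  (forall i, eqmodX n (F i) (G i)) -> eqmodX n (\prod_i F i) (\prod_i G i).
Proof.
move=> FG; apply: (big_ind2 (eqmodX n)) => // [|f f' g g'].
  exact: eqmodX_refl.
exact: eqmodXM.
Qed.

(** By [shanks_sumS], step [n] adds only the exponents [M (3 M + 1)] and [M (3 M - 1)] with
    [M = n + 1], for which [12 e + 1] is [(6 M + 1)^2] and [(6 M - 1)^2]. *)
Lemma coef_shanks_sum n e :
  (shanks_sum ('X : {poly R}) n)`_e != 0 ->
  exists m, (12 * e + 1 = m ^ 2)%N.
Proof.
elim: n => [|n IHn].
  rewrite shanks_sum0 coef1; case: e => [_|e]; last by rewrite eqxx.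
  by exists 1%N.
rewrite shanks_sumS coefD -signr_odd mulr_sign.
have [->|/IHn //] := eqVneq (shanks_sum ('X : {poly R}) n)`_e 0; rewrite add0r.
have [-> _|ne1] := eqVneq e (n.+1 * (3 * n + 4))%N.
  by exists (6 * n + 7)%N; lia.
have [-> _|ne2] := eqVneq e (n.+1 * (3 * n + 2))%N.
  by exists (6 * n + 5)%N; lia.
rewrite (fun_if (fun f : {poly R} => f`_e)) coefN coefD !coefXn.
by rewrite (negPf ne1) (negPf ne2) addr0 oppr0 if_same eqxx.
Qed.

(** The term [s = 0] is the product itself; for [s >= 1] the exponent [2 s n + s (s + 1)] is at
    least [2 n + 2]. *)
Lemma qfact_shanks_sum n :
  eqmodX (2 * n).+2 (\prod_(i < n) (1 - 'X^(2 * i.+1)))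
    (shanks_sum ('X : {poly R}) n).
Proof.
rewrite /shanks_sum big_ord_recl /= {1}/shanks_term.
rewrite /qfact_ratio big_mkord !muln0 !mul0n mul1r mulr1.
pose c (s : 'I_n) : {poly R} := (-1) ^+ s.+1 * qfact_ratio 'X s.+1 n *
  'X^(2 * s * n + s * (s + 3)).
exists (- \sum_(s < n) c s); rewrite mulNr mulr_suml.
suff -> : \sum_(s < n) shanks_term 'X n (bump 0 s) =
    \sum_(s < n) c s * 'X^((2 * n).+2) by rewrite addrK.
apply: eq_bigr => s _; rewrite /shanks_term /c -[RHS]mulrA -exprD; congr (_ * 'X^_).
rewrite /bump; lia.
Qed.

Lemma coef_qfact N e : (e <= N)%N ->
  (\prod_(i < N./2) (1 - 'X^(2 * i.+1)) : {poly R})`_e != 0 ->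
  exists m, (12 * e + 1 = m ^ 2)%N.
Proof.
move=> le_eN; rewrite (eqmodX_coef (qfact_shanks_sum _)); last by lia.
exact: coef_shanks_sum.
Qed.

(** Frobenius is additive, so [h ^+ p] is the sum of the [h_m^p X^(m p)]. *)
Lemma coef_exp_pchar p h i :
  p \in [pchar R] -> ~~ (p %| i)%N -> (h ^+ p)`_i = 0.
Proof.
move=> pcharR pNi; have pcharP : p \in [pchar {poly R}] by rewrite pchar_poly.
rewrite -(pFrobenius_autE pcharP) -{1}[h]coefK poly_def rmorph_sum coef_sum.
apply: big1 => m _; rewrite /= pFrobenius_autE exprZn -exprM coefZ coefXn.
case: eqP => [im|_]; last by rewrite mulr0.
by rewrite im dvdn_mull in pNi.
Qed.

End PowerSeriesModXn.

Section GeneratingFunction.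
Variable R : comNzRingType.

Definition geom_trunc N i : {poly R} := \sum_(m < N.+1) 'X^(m * i).

Lemma geom_truncM N i : (0 < i)%N ->
  eqmodX N.+1 (geom_trunc N i * (1 - 'X^i)) 1.
Proof.
move=> i_gt0; exists (- 'X^(i * N.+1 - N.+1)).
rewrite /geom_trunc; under eq_bigr => m _ do rewrite mulnC exprM.
rewrite mulrC -opprB mulNr -subrX1 opprB -exprM mulNr -exprD; congr (_ - 'X^_).
by rewrite subnK // leq_pmull.
Qed.

(** Expanding the product picks a multiplicity at most [N] for each colored part, exactly the
    functions counted by [a]. *)
Lemma coef_multicolored r s N :
  (a r s N)%:R =
    (\prod_(i < N) geom_trunc N i.+1 ^+ ncolors r s i.+1 : {poly R})`_N.
Proof.
have -> : \prod_(i < N) geom_trunc N i.+1 ^+ ncolors r s i.+1 =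
    \prod_(x : colored_part r s N) geom_trunc N (part_size x).
  rewrite -(@sig_big_dep _ _ _ 'I_N (fun i => 'I_(ncolors r s i.+1)) xpredT
    (fun _ => xpredT) (fun i _ => geom_trunc N i.+1)).
  by apply: eq_bigr => i _; rewrite prodr_const card_ord.
rewrite bigA_distr_bigA coef_sum /a -sum1_card natr_sum big_mkcond /=.
apply: eq_bigr => m _; rewrite inE -expr_sum coefXn eq_sym.
by case: eqP.
Qed.

Lemma prod_even_parts N :
  \prod_(i < N) (if odd i.+1 then 1 else 1 - 'X^(i.+1)) =
  \prod_(i < N./2) (1 - 'X^(2 * i.+1)) :> {poly R}.
Proof.
elim: N => [|N IHN]; first by rewrite !big_ord0.
rewrite big_ord_recr {}IHN /= uphalf_half.
case: (boolP (odd N)) => oN /=; last by rewrite mulr1.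
rewrite add1n big_ord_recr /=; congr (_ * (1 - 'X^_)); lia.
Qed.

(** Odd parts have the same factor on both sides. For an even part [i], with [G] its truncated
    geometric series, [(1 - X^i)^d] cancels [G^d] and leaves [G^r]. *)
Lemma multicolored_series r d N :
  eqmodX N.+1 (\prod_(i < N) geom_trunc N i.+1 ^+ ncolors r (r + d) i.+1)
    ((\prod_(i < N./2) (1 - 'X^(2 * i.+1))) ^+ d *
     (\prod_(i < N) geom_trunc N i.+1) ^+ (r + d)).
Proof.
rewrite -prod_even_parts -!prodrXl -big_split /=; apply: eqmodX_prod => i.
rewrite /ncolors /=; case: (odd i) => /=; last first.
  by rewrite expr1n mul1r; apply: eqmodX_refl.
have [h GD] := eqmodXX d (@geom_truncM N i.+1 isT).
exists (- (geom_trunc N i.+1 ^+ r * h)).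
rewrite exprMn expr1n in GD.
have -> : (1 - 'X^(i.+1)) ^+ d * geom_trunc N i.+1 ^+ (r + d) =
    geom_trunc N i.+1 ^+ r * (geom_trunc N i.+1 ^+ d * (1 - 'X^(i.+1)) ^+ d).
  by rewrite exprD; ring.
by rewrite GD; ring.
Qed.

End GeneratingFunction.

Local Close Scope ring_scope.

Theorem theorem1p16 (p r : nat) (p_prime : prime p) (p_ge5 : 5 <= p)
    (r_range : 1 <= r <= p - 1)
    (r_nonres : quadratic_nonresidue p (12 * r + 1))
    (n k j : nat) (le_jk : j <= k) :
  a (p * (k - j) + (p - 1)) (p * k + p) (p * n + r) = 0 %[mod p].
Proof.
set N := p * n + r; set r0 := p * (k - j) + (p - 1).
have -> : p * k + p = r0 + (p * j + 1) by rewrite /r0; nia.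
have pcharF : p \in [pchar 'F_p]%R by rewrite pchar_Fp.
apply/eqP; rewrite mod0n -/(p %| _) (dvdn_pcharf pcharF) coef_multicolored.
rewrite (eqmodX_coef (multicolored_series _ _ _ _)) //.
rewrite (_ : r0 + (p * j + 1) = k.+1 * p); last by rewrite /r0; nia.
(* Regroup as [f_2 * H^p]; the convolution pairs coefficient [e] of [f_2] with coefficient [N - e]
   of [H^p]. *)
rewrite exprD expr1 (mulnC p) !exprM mulrAC -exprMn mulrC coefM.
apply/eqP/big1 => -[e /=]; rewrite ltnS => le_eN _.
set E : {poly 'F_p} := (\prod_(i < N./2) _)%R.
have [->|/(coef_qfact le_eN) [m sqm]] := eqVneq (E`_e)%R 0%R.
  by rewrite mul0r.
(* If [p] divided [N - e], then [e = r] modulo [p], and [12 r + 1] would be congruent to [m ^ 2]. *)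
rewrite coef_exp_pchar ?mulr0 //; apply/negP => p_dvd.
case: r_nonres => _; apply; exists m; rewrite -sqm; apply/eqP.
rewrite eqn_modDr -[X in _ == X]modnMmr -[X in X == _]modnMmr.
suff -> : e = r %[mod p] by [].
by apply/eqP; rewrite eq_sym -(modnMDl n r) (mulnC n) -/N eqn_mod_dvd.
Qed.
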